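(* Let $\mathbb{K}$ be either $\mathbb{Z}$ or $\mathbb{R}$. Let $\mathcal{A},\mathcal{B}$ be $\overline{\mathbb{K}}$-categories, let $\mathbf{D},\mathbf{E}$ be $\overline{\mathbb{K}}$-extended L-convex sets, let $F,G:\mathcal{A}\to\mathcal{B}$ be $\overline{\mathbb{K}}$-functors, and let $\Phi,\Psi:\mathbf{D}\to\mathbf{E}$ be homomorphisms. Then: (i) $F\Rightarrow G$ if and only if $[F,\overline{\mathbb{K}}]\Rightarrow[G,\overline{\mathbb{K}}]$; (ii) $\Phi\Rightarrow\Psi$ if and only if $[\![\Phi,\overline{\mathbb{K}}]\!]\Rightarrow[\![\Psi,\overline{\mathbb{K}}]\!]$.
   Context: **Extended arithmetic.** $\mathbb{K}$ denotes either $\mathbb{Z}$ or $\mathbb{R}$. On $\mathbb{K}\cup\{-\infty,\infty\}$ use the usual total order, with $-\infty$ least and $\infty$ greatest; $\sup$ and $\inf$ are with respect to it, so $\sup\emptyset=-\infty$ and $\inf\emptyset=\infty$. Addition extends that of $\mathbb{K}$: $x+y=\infty$ if $x=\infty$ or $y=\infty$; otherwise $x+y=-\infty$ if $x=-\infty$ or $y=-\infty$. Subtraction extends that of $\mathbb{K}$: $y-x=-\infty$ if $x=\infty$ or $y=-\infty$; otherwise $y-x=\infty$ if $y=\infty$ or $x=-\infty$. (In particular $\infty-\infty=-\infty$ and $(-\infty)-(-\infty)=-\infty$.) **$\overline{\mathbb{K}}$-categories.** A $\overline{\mathbb{K}}$-category $\mathcal{A}$ is a pair $(\mathrm{Ob}(\mathcal{A}),d_{\mathcal{A}})$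 of a set and a map $d_{\mathcal{A}}:\mathrm{Ob}(\mathcal{A})\times\mathrm{Ob}(\mathcal{A})\to\mathbb{K}\cup\{-\infty,\infty\}$ with $d_{\mathcal{A}}(a,b)+d_{\mathcal{A}}(b,c)\ge d_{\mathcal{A}}(a,c)$ and $0\ge d_{\mathcal{A}}(a,a)$ for all $a,b,c$. A $\overline{\mathbb{K}}$-functor (nonexpansive map) $F:\mathcal{A}\to\mathcal{B}$ is a map $\mathrm{Ob}(F):\mathrm{Ob}(\mathcal{A})\to\mathrm{Ob}(\mathcal{B})$ with $d_{\mathcal{A}}(a,a')\ge d_{\mathcal{B}}(F(a),F(a'))$ for all $a,a'$. $\overline{\mathbb{K}}$ itself is the $\overline{\mathbb{K}}$-category with set of objects $\mathbb{K}\cup\{-\infty,\infty\}$ and $d_{\overline{\mathbb{K}}}(x,y)=y-x$. **$\overline{\mathbb{K}}$-extended L-convex sets.** A $\overline{\mathbb{K}}$-extended L-convex set $\mathbf{D}$ is a pair $(\mathrm{Ind}(\mathbf{D}),\mathbf{D}_0)$ of a (possibly infinite) set $\mathrm{Ind}(\mathbf{D})$ and a subset $\mathbf{D}_0$ of the set $\overline{\mathbb{K}}^{\mathrm{Ind}(\mathbf{D})}$ of all maps $\mathrm{Ind}(\mathbf{D})\to\mathbb{K}\cup\{-\infty,\infty\}$ such that: (order completeness) for every subset $S\subseteq\mathbf{D}_0$ (including $S=\emptyset$), the coordinate-wise $\inf$ and the coordinate-wise $\sup$ of $S$ belong to $\mathbf{D}_0$; (weight completeness) $p+\alpha\cdot\mathbf{1}\in\mathbf{D}_0$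 for all $p\in\mathbf{D}_0$ and $\alpha\in\mathbb{K}\cup\{-\infty,\infty\}$, where $(p+\alpha\cdot\mathbf{1})(v)=p(v)+\alpha$. A homomorphism $\Phi:\mathbf{D}\to\mathbf{E}$ is a map $\mathrm{Ind}(\Phi):\mathrm{Ind}(\mathbf{E})\to\mathrm{Ind}(\mathbf{D})$ such that $\Phi_0(p):=p\circ\mathrm{Ind}(\Phi)\in\mathbf{E}_0$ for all $p\in\mathbf{D}_0$. $\overline{\mathbb{K}}$ itself is also regarded as the $\overline{\mathbb{K}}$-extended L-convex set $(\{\ast\},\mathbb{K}\cup\{-\infty,\infty\})$, identifying $\mathbb{K}\cup\{-\infty,\infty\}$ with $\overline{\mathbb{K}}^{\{\ast\}}$. **Canonical orderings.** For $\overline{\mathbb{K}}$-functors $F,G:\mathcal{A}\to\mathcal{B}$: $F\Rightarrow G$ iff $0\ge d_{\mathcal{B}}(F(a),G(a))$ for all $a\in\mathrm{Ob}(\mathcal{A})$. For homomorphisms $\Phi,\Psi:\mathbf{D}\to\mathbf{E}$: $\Phi\Rightarrow\Psi$ iff $\Phi_0(p)\ge\Psi_0(p)$ coordinate-wise for all $p\in\mathbf{D}_0$. **Constructions on objects.** For a $\overline{\mathbb{K}}$-category $\mathcal{A}$, $[\mathcal{A},\overline{\mathbb{K}}]$ is the $\overline{\mathbb{K}}$-extended L-convex set $(\mathrm{Ob}(\mathcal{A}),[\mathcal{A},\overline{\mathbb{K}}]_0)$, where $[\mathcal{A},\overline{\mathbb{K}}]_0\subseteq\overline{\mathbb{K}}^{\mathrm{Ob}(\mathcal{A})}$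 is the set of all $\overline{\mathbb{K}}$-functors $\mathcal{A}\to\overline{\mathbb{K}}$. For a $\overline{\mathbb{K}}$-extended L-convex set $\mathbf{D}$, $[\![\mathbf{D},\overline{\mathbb{K}}]\!]$ is the $\overline{\mathbb{K}}$-category whose set of objects $[\![\mathbf{D},\overline{\mathbb{K}}]\!]_0$ is the set of all homomorphisms $\mathbf{D}\to\overline{\mathbb{K}}$, with distance $d(\Phi,\Psi)=\sup_{p\in\mathbf{D}_0}\{\Psi_0(p)-\Phi_0(p)\}$. There is a bijection $\pi_{\mathbf{D}}:\mathrm{Ind}(\mathbf{D})\to[\![\mathbf{D},\overline{\mathbb{K}}]\!]_0$, $v\mapsto\pi_v$, where $\mathrm{Ind}(\pi_v)(\ast)=v$ (so $(\pi_v)_0(p)=p(v)$). **Constructions on maps.** For a $\overline{\mathbb{K}}$-functor $F:\mathcal{A}\to\mathcal{B}$, $[F,\overline{\mathbb{K}}]:[\mathcal{B},\overline{\mathbb{K}}]\to[\mathcal{A},\overline{\mathbb{K}}]$ is the homomorphism with $\mathrm{Ind}([F,\overline{\mathbb{K}}])=\mathrm{Ob}(F)$. For a homomorphism $\Phi:\mathbf{D}\to\mathbf{E}$, $[\![\Phi,\overline{\mathbb{K}}]\!]:[\![\mathbf{E},\overline{\mathbb{K}}]\!]\to[\![\mathbf{D},\overline{\mathbb{K}}]\!]$ is the $\overline{\mathbb{K}}$-functor with $\mathrm{Ob}([\![\Phi,\overline{\mathbb{K}}]\!])=\pi_{\mathbf{D}}\circ\mathrm{Ind}(\Phi)\circ\pi_{\mathbf{E}}^{-1}$,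 i.e. $\pi_w\mapsto\pi_{\mathrm{Ind}(\Phi)(w)}$. *)

(* Defs.v *)
From mathcomp Require Import all_boot all_order all_algebra.
From mathcomp Require Import all_classical all_reals ereal.

Set Implicit Arguments.
Unset Strict Implicit.
Unset Printing Implicit Defensive.

Import Order.TTheory GRing.Theory Num.Theory.

Local Open Scope classical_set_scope.
Local Open Scope ring_scope.
Local Open Scope ereal_scope.

(* The ground domain K is either Z or (a model of) the real numbers. *)
Inductive ground : Type :=
| GroundZ
| GroundR of realType.

Definition ground_dom (K : ground) : realDomainType :=
  match K with
  | GroundZ => int
  | GroundR R => R
  end.

Coercion ground_dom : ground >-> realDomainType.

Section ExtendedArithmetic.
Context {K : ground}.
Implicit Types (x y z : \bar K) (S : set (\bar K)).

(* +oo absorbs in the dual addition of extended numbers, whereas -oo absorbs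
   in the ordinary one. The subtraction uses the latter: y - x is -oo as soon
   as x = +oo or y = -oo. *)
Definition ext_add x y : \bar K := (x + y)%dE.
Definition ext_sub y x : \bar K := (y - x)%E.

(* ext_supP and ext_infP below show that these are the actual least upper
   bound and greatest lower bound of every S. *)
Definition ext_sup S : \bar K := supremum -oo S.
Definition ext_inf S : \bar K := infimum +oo S.

End ExtendedArithmetic.

Lemma int_supremums_neq0 (S : set (\bar int)) : supremums S !=set0.
Proof.
have [[m mS]|noub] := pselect (exists m : int, ubound S m%:E); last first.
  exists +oo; split => [x _|b bS]; first exact: leey.
  case: b bS => [b||] bS //; first by exfalso; apply: noub; exists b.
  exfalso; apply: noub; exists 0%R => x /bS.
  by rewrite leeNy_eq => /eqP ->.
have [[n nS]|nofin] := pselect (exists n : int, S n%:E); last first.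
  exists -oo; split => [[x||] xS|b _]; last 1 first.
  - exact: leNye.
  - by exfalso; apply: nofin; exists x.
  - by have := mS _ xS; rewrite leye_eq.
  - by [].
pose P := [pred k : nat | `[< ubound S (n + k%:Z)%:E >]].
have exP : exists k, P k.
  exists `|(m - n)%R|%N; apply/asboolP.
  have nm : (n <= m)%R by have := mS _ nS; rewrite lee_fin.
  by rewrite gez0_abs ?subr_ge0// addrC subrK.
case: (ex_minnP exP) => k /asboolP kS kmin.
exists (n + k%:Z)%:E; split => // -[b||] bS; last 2 first.
- exact: leey.
- by have := bS _ nS.
have nb : (n <= b)%R by have := bS _ nS; rewrite lee_fin.
have : P `|(b - n)%R|%N.
  by apply/asboolP; rewrite gez0_abs ?subr_ge0// addrC subrK.
move=> /kmin; rewrite -lez_nat gez0_abs ?subr_ge0// => kb.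
by rewrite lee_fin -lerBrDl.
Qed.

Lemma ext_supremums_neq0 (K : ground) (S : set (\bar K)) : supremums S !=set0.
Proof.
case: K S => [|R] S; first exact: int_supremums_neq0.
exact: ereal_supremums_neq0.
Qed.

Lemma ext_supP (K : ground) (S : set (\bar K)) : supremums S (ext_sup S).
Proof.
rewrite /ext_sup /supremum; case: ifPn => [/eqP ->|_].
  by split => // b _; exact: leNye.
by have [x Sx] := ext_supremums_neq0 S; case: xgetP => // /(_ x).
Qed.

Lemma ext_infP (K : ground) (S : set (\bar K)) : infimums S (ext_inf S).
Proof.
rewrite /ext_inf /infimum; case: ifPn => [/eqP ->|_].
  by split => // b _; exact: leey.
have [x [ubx lbx]] := ext_supremums_neq0 (lbound S).
have Sx : infimums S x.
  by split => // y Sy; apply: lbx => z; apply.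
by case: xgetP => // /(_ x).
Qed.

Section ExtendedLemmas.
Import DualAddTheory.
Variable K : ground.
Implicit Types (x y z : \bar K) (S : set (\bar K)).

Lemma ext_sup_ub S x : S x -> x <= ext_sup S.
Proof. by have [ub _] := ext_supP S; exact: ub. Qed.

Lemma ext_sup_le S y : (forall x, S x -> x <= y) -> ext_sup S <= y.
Proof. by have [_ lub] := ext_supP S => Sy; exact: lub. Qed.

Lemma ext_inf_lb S x : S x -> ext_inf S <= x.
Proof. by have [lb _] := ext_infP S; exact: lb. Qed.

Lemma ext_inf_ge S y : (forall x, S x -> y <= x) -> y <= ext_inf S.
Proof. by have [_ glb] := ext_infP S => Sy; exact: glb. Qed.

Lemma ext_addA x y z : ext_add (ext_add x y) z = ext_add x (ext_add y z).
Proof. by rewrite /ext_add daddeA. Qed.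

Lemma ext_addC x y : ext_add x y = ext_add y x.
Proof. by rewrite /ext_add daddeC. Qed.

Lemma ext_add_le x y z t : x <= y -> z <= t -> ext_add x z <= ext_add y t.
Proof. exact: lee_dD. Qed.

Lemma ext_sub_le x y z : (ext_sub y x <= z) = (y <= ext_add x z).
Proof.
move: x y z => [x||] [y||] [z||]; rewrite /ext_sub /ext_add //=.
all: rewrite ?(leNye, leey) //.
by rewrite -EFinB -dEFinD !lee_fin lerBlDl.
Qed.

Lemma ext_sub_self x : ext_sub x x <= 0.
Proof. by rewrite ext_sub_le; case: x => [x||] //; rewrite /ext_add dadde0. Qed.

Lemma ext_sub_trans x y z : ext_sub z x <= ext_add (ext_sub y x) (ext_sub z y).
Proof.
rewrite ext_sub_le -ext_addA.
apply: (@le_trans _ _ (ext_add y (ext_sub z y))); first by rewrite -ext_sub_le.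
by apply: ext_add_le => //; rewrite -ext_sub_le.
Qed.

End ExtendedLemmas.

Record Kcategory (K : ground) := MkKcategory {
  Ob :> Type;
  dist : Ob -> Ob -> \bar K;
  dist_triangle : forall a b c, ext_add (dist a b) (dist b c) >= dist a c;
  dist_refl : forall a, 0 >= dist a a
}.

Definition nonexpansive (K : ground) (A B : Kcategory K) (f : A -> B) : Prop :=
  forall a a' : A, dist a a' >= dist (f a) (f a').

Record Kfunctor (K : ground) (A B : Kcategory K) := MkKfunctor {
  Fob :> A -> B;
  Fob_nonexpansive : nonexpansive Fob
}.

Definition Kbar_category (K : ground) : Kcategory K :=
  @MkKcategory K (\bar K) (fun x y => ext_sub y x)
    (fun x y z => ext_sub_trans x y z) (fun x => ext_sub_self x).

Record Lconvex (K : ground) := MkLconvex {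
  Ind : Type;
  Lset : set (Ind -> \bar K);
  Lset_inf : forall S : set (Ind -> \bar K), S `<=` Lset ->
    Lset (fun v => ext_inf [set p v | p in S]);
  Lset_sup : forall S : set (Ind -> \bar K), S `<=` Lset ->
    Lset (fun v => ext_sup [set p v | p in S]);
  Lset_weight : forall (p : Ind -> \bar K) (alpha : \bar K), Lset p ->
    Lset (fun v => ext_add (p v) alpha)
}.

Arguments Lset {K} l _.

(* A homomorphism D -> E acts contravariantly on indices. *)
Record Lhom (K : ground) (D E : Lconvex K) := MkLhom {
  Ind_hom : Ind E -> Ind D;
  Lhom_Lset : forall p, Lset D p -> Lset E (p \o Ind_hom)
}.

Definition Lhom_app (K : ground) (D E : Lconvex K) (Phi : Lhom D E)
    (p : Ind D -> \bar K) : Ind E -> \bar K :=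
  p \o Ind_hom Phi.

Definition Kbar_Lconvex (K : ground) : Lconvex K :=
  @MkLconvex K unit setT (fun _ _ => I) (fun _ _ => I) (fun _ _ _ => I).

Definition Kfunctor_le (K : ground) (A B : Kcategory K) (F G : Kfunctor A B)
    : Prop :=
  forall a : A, 0 >= dist (F a) (G a).

Definition Lhom_le (K : ground) (D E : Lconvex K) (Phi Psi : Lhom D E)
    : Prop :=
  forall p, Lset D p -> forall w : Ind E, Lhom_app Phi p w >= Lhom_app Psi p w.

(* The L-convex set [A, Kbar]. *)
Section FunctorSet.
Variables (K : ground) (A : Kcategory K).

Definition functor_set : set (A -> \bar K) :=
  [set f | @nonexpansive K A (Kbar_category K) f].

Lemma functor_setP (f : A -> \bar K) :
  functor_set f <-> forall a a', f a' <= ext_add (f a) (dist a a').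
Proof. by split => h a a'; have := h a a'; rewrite /= ext_sub_le. Qed.

Lemma functor_set_inf (S : set (A -> \bar K)) : S `<=` functor_set ->
  functor_set (fun a => ext_inf [set p a | p in S]).
Proof.
move=> SA a a' /=; rewrite ext_sub_le ext_addC -ext_sub_le.
apply: ext_inf_ge => _ [p Sp <-]; rewrite ext_sub_le ext_addC.
apply: (@le_trans _ _ (p a')); first by apply: ext_inf_lb; exists p.
by have /functor_setP := SA p Sp; exact.
Qed.

Lemma functor_set_sup (S : set (A -> \bar K)) : S `<=` functor_set ->
  functor_set (fun a => ext_sup [set p a | p in S]).
Proof.
move=> SA; apply/functor_setP => a a'.
apply: ext_sup_le => _ [p Sp <-].
have /functor_setP/(_ a a') := SA p Sp => /le_trans; apply.
by apply: ext_add_le => //; apply: ext_sup_ub; exists p.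
Qed.

Lemma functor_set_weight (p : A -> \bar K) (alpha : \bar K) : functor_set p ->
  functor_set (fun a => ext_add (p a) alpha).
Proof.
move=> /functor_setP pA; apply/functor_setP => a a'.
by rewrite ext_addA (ext_addC alpha) -ext_addA; exact: ext_add_le.
Qed.

Definition functor_Lconvex : Lconvex K :=
  MkLconvex functor_set_inf functor_set_sup functor_set_weight.

End FunctorSet.

(* The Kbar-category [[D, Kbar]]. *)
Section HomCategory.
Variables (K : ground) (D : Lconvex K).

Definition hom_dist (Phi Psi : Lhom D (Kbar_Lconvex K)) : \bar K :=
  ext_sup [set ext_sub (Lhom_app Psi p tt) (Lhom_app Phi p tt) | p in Lset D].

Lemma hom_dist_triangle Phi Psi Xi :
  ext_add (hom_dist Phi Psi) (hom_dist Psi Xi) >= hom_dist Phi Xi.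
Proof.
apply: ext_sup_le => _ [p Dp <-].
apply: (le_trans (ext_sub_trans _ (Lhom_app Psi p tt) _)).
by apply: ext_add_le; apply: ext_sup_ub; exists p.
Qed.

Lemma hom_dist_refl Phi : 0 >= hom_dist Phi Phi.
Proof. by apply: ext_sup_le => _ [p Dp <-]; exact: ext_sub_self. Qed.

Definition hom_category : Kcategory K :=
  MkKcategory hom_dist_triangle hom_dist_refl.

(* The bijection pi_D, and its inverse. *)
Definition proj_hom (v : Ind D) : hom_category :=
  @MkLhom K D (Kbar_Lconvex K) (fun=> v) (fun _ _ => I).

Definition proj_hom_inv (Phi : hom_category) : Ind D := Ind_hom Phi tt.

Lemma proj_homK : cancel proj_hom proj_hom_inv.
Proof. by []. Qed.

Lemma proj_hom_invK : cancel proj_hom_inv proj_hom.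
Proof.
case=> f fD; rewrite /proj_hom /proj_hom_inv /=.
have ff : (fun=> f tt) = f by apply/funext => -[].
move: fD; rewrite -ff => fD; congr MkLhom; exact: Prop_irrelevance.
Qed.

End HomCategory.

(* The homomorphism [F, Kbar] : [B, Kbar] -> [A, Kbar]. *)
Section FunctorHom.
Variables (K : ground) (A B : Kcategory K) (F : Kfunctor A B).

Lemma functor_hom_subproof (p : B -> \bar K) :
  Lset (functor_Lconvex B) p -> Lset (functor_Lconvex A) (p \o F).
Proof.
move=> pB a a' /=; apply: le_trans (pB (F a) (F a')) _.
exact: (Fob_nonexpansive F).
Qed.

Definition functor_hom : Lhom (functor_Lconvex B) (functor_Lconvex A) :=
  @MkLhom K (functor_Lconvex B) (functor_Lconvex A) F functor_hom_subproof.

End FunctorHom.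

(* The functor [[Phi, Kbar]] : [[E, Kbar]] -> [[D, Kbar]]. *)
Section HomFunctor.
Variables (K : ground) (D E : Lconvex K) (Phi : Lhom D E).

Definition hom_functor_ob : hom_category E -> hom_category D :=
  @proj_hom K D \o Ind_hom Phi \o @proj_hom_inv K E.

Lemma hom_functor_nonexpansive : nonexpansive hom_functor_ob.
Proof.
move=> f g; apply: ext_sup_le => _ [p Dp <-].
by apply: ext_sup_ub; exists (Lhom_app Phi p) => //; exact: Lhom_Lset.
Qed.

Definition hom_functor : Kfunctor (hom_category E) (hom_category D) :=
  MkKfunctor hom_functor_nonexpansive.

End HomFunctor.

(* Main.v *)
Require Import Defs.
From mathcomp Require Import all_boot all_order all_algebra.
From mathcomp Require Import all_classical ereal.

(** Both equivalences rest on reading a nonpositive distance as an order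
    relation tested by extended-valued functions.

    Since 0 is neutral for the extended addition, the adjunction between
    addition and subtraction turns [ext_sub y x <= 0] into [y <= x]
    ([ext_sub_le0]), infinite values included.

    For (i), [dist a b <= 0] holds exactly when every functor [p : A -> Kbar]
    satisfies [p b <= p a] ([dist_le0P]). This is the order-theoretic part of
    the Yoneda lemma: the test function [dist a _] already decides the matter.
    Apply it to the pair [F a], [G a] for each [a].

    For (ii), the distance on homomorphisms into Kbar is by definition a
    supremum of differences over the test functions in [Lset D], so the same
    reading needs no representable function ([hom_dist_le0P]). What remains is
    that every object of the category of homomorphisms out of [E] is a
    projection at an index [w] of [E]. *)

Set Implicit Arguments.
Unset Strict Implicit.
Unset Printing Implicit Defensive.

Import Order.TTheory DualAddTheory.

Local Open Scope ereal_scope.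

Lemma ext_adde0 (K : ground) (x : \bar K) : ext_add x 0 = x.
Proof. exact: dadde0. Qed.

(** The conventions [oo - oo = -oo] and [-oo - (-oo) = -oo] are what makes this
    hold at equal infinite arguments. *)
Lemma ext_sub_le0 (K : ground) (x y : \bar K) : (ext_sub y x <= 0) = (y <= x).
Proof. by rewrite ext_sub_le ext_adde0. Qed.

Lemma dist_functor_set (K : ground) (A : Kcategory K) (a : A) :
  functor_set (dist a).
Proof. by apply/functor_setP => b c; exact: dist_triangle. Qed.

(** From right to left, the hypothesis at [p = dist a] gives
    [dist a b <= dist a a <= 0]. *)
Lemma dist_le0P (K : ground) (A : Kcategory K) (a b : A) :
  dist a b <= 0 <-> forall p, functor_set p -> p b <= p a.
Proof.
split=> [ab0 p /functor_setP pA|pab].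
  rewrite -[leRHS]ext_adde0; apply: le_trans (pA a b) _.
  exact: ext_add_le.
exact: le_trans (pab _ (dist_functor_set a)) (dist_refl a).
Qed.

Lemma hom_dist_le0P (K : ground) (D : Lconvex K)
    (f g : Lhom D (Kbar_Lconvex K)) :
  hom_dist f g <= 0 <->
  forall p, Lset D p -> Lhom_app g p tt <= Lhom_app f p tt.
Proof.
split=> [fg0 p Dp|fg].
  rewrite -ext_sub_le0; apply: le_trans fg0.
  by apply: ext_sup_ub; exists p.
by apply: ext_sup_le => _ [p Dp <-]; rewrite ext_sub_le0; exact: fg.
Qed.

Theorem theorem3p16 (K : ground) (A B : Kcategory K) (D E : Lconvex K)
    (F G : Kfunctor A B) (Phi Psi : Lhom D E) :
  (Kfunctor_le F G <-> Lhom_le (functor_hom F) (functor_hom G)) /\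
  (Lhom_le Phi Psi <-> Kfunctor_le (hom_functor Phi) (hom_functor Psi)).
Proof.
split; split.
- by move=> FG p Bp a; have /dist_le0P := FG a; exact.
- by move=> FG a; apply/dist_le0P => p Bp; exact: FG.
- move=> PhiPsi f; apply/hom_dist_le0P => p Dp.
  exact: PhiPsi p Dp (proj_hom_inv f).
- move=> PhiPsi p Dp w.
  by have /hom_dist_le0P := PhiPsi (proj_hom w); exact.
Qed.
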